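(* Let $\xi\subset\mathbb{Z}^2$ be a set of monomial exponents of some toric surface with $(0,0)\notin\mathrm{Conv}(\xi)$, and let $L(x,y)=ax+by$ with $a,b\in\mathbb{Z}$ not both zero and $L(\gamma)\geq 0$ for all $\gamma\in\xi$. Then the iteration of the algorithm following $L$ eventually produces a semigroup generated by two elements: for every sequence $\xi_0=\xi,\xi_1,\xi_2,\ldots$ obtained by iterating the algorithm following $L$ (with any of the possible choices of $L$ at each step) there is $k\geq 0$ such that the semigroup $\mathbb{Z}_{\geq 0}\xi_k$ is generated by two elements.
   Context: For a finite set $\xi=\{\gamma_1,\ldots,\gamma_r\}\subset\mathbb{Z}^2$ of distinct elements, $\mathbb{Z}\xi$ is its integer span, $\mathbb{Z}_{\geq0}\xi$ is the additive semigroup of non-negative integer combinations of $\xi$, and $\mathrm{Conv}(\xi)$ is its convex hull in $\mathbb{R}^2$. $\xi$ is a set of monomial exponents of a toric surface if $\mathbb{Z}\xi=\mathbb{Z}^2$. The algorithm is applied to such sets satisfying $(0,0)\notin\mathrm{Conv}(\xi)$. One step. For $i\neq j$ with $\det(\gamma_i\ \gamma_j)\neq0$ put $A_i=\{\gamma_k-\gamma_i\mid k\neq i,j,\ \det(\gamma_k\ \gamma_j)\neq0\}$, $A_j=\{\gamma_k-\gamma_j\mid k\neq i,j,\ \det(\gamma_k\ \gamma_i)\neq0\}$, and $\xi_{i,j}=A_i\cup A_j\cup\{\gamma_i,\gamma_j\}$. Choices of $L$. Let $L:\mathbb{R}^2\to\mathbb{R}$ be a nonzero linear form with integer coefficients and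 $L\geq0$ on $\xi$. One says that $L$ chooses $\gamma_i,\gamma_j\in\xi$ if $\det(\gamma_i\ \gamma_j)\neq0$, $L(\gamma_i)\leq L(\gamma_k)$ for all $\gamma_k\in\xi$, $L(\gamma_j)\leq L(\gamma_k)$ for all $\gamma_k\in\xi$ with $\det(\gamma_i\ \gamma_k)\neq0$, and $(0,0)\notin\mathrm{Conv}(\xi_{i,j})$. Such a pair always exists but need not be unique. Iterating the algorithm following $L$ from $\xi$ means forming a sequence $\xi_0=\xi,\xi_1,\xi_2,\ldots$ where, for each $k$, $\xi_{k+1}=(\xi_k)_{i,j}$ for some pair $\gamma_i,\gamma_j\in\xi_k$ chosen by $L$ (for the set $\xi_k$). The algorithm stops when $\mathbb{Z}_{\geq0}\xi_k$ is generated by two elements. *)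

(* Defs.v *)
From mathcomp Require Import all_boot all_order all_algebra finmap.
From mathcomp Require Import all_classical all_reals convex.

Set Implicit Arguments.
Unset Strict Implicit.
Unset Printing Implicit Defensive.
Import Order.TTheory GRing.Theory Num.Theory.

Local Open Scope classical_set_scope.
Local Open Scope ring_scope.

Notation Z2 := (int * int)%type.

Definition det2 (u v : Z2) : int := u.1 * v.2 - u.2 * v.1.

Definition int_span (xi : {fset Z2}) : set Z2 :=
  [set x | exists c : Z2 -> int, x = \sum_(g <- xi) g *~ c g].

Definition semigroup_span (xi : {fset Z2}) : set Z2 :=
  [set x | exists c : Z2 -> nat, x = \sum_(g <- xi) g *+ c g].

Definition monomial_exponents (xi : {fset Z2}) : Prop := int_span xi = setT.

Definition generated_by_two (S : set Z2) : Prop :=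
  exists u v : Z2, u != v /\ S = semigroup_span [fset u; v]%fset.

Definition embed (R : realType) (g : Z2) : R^o * R^o := (g.1%:~R, g.2%:~R).

Definition Conv (R : realType) (xi : {fset Z2}) : set (R^o * R^o) :=
  smallest (@convex_set R (R^o * R^o)%type) (embed R @` [set` xi]).
Arguments Conv : clear implicits.

(* [A_of xi gi gj] is A_i; A_j is obtained by exchanging [gi] and [gj]. *)
Definition A_of (xi : {fset Z2}) (gi gj : Z2) : {fset Z2} :=
  [fset g - gi | g in xi & [&& g != gi, g != gj & det2 g gj != 0]]%fset.

Definition alg_step (xi : {fset Z2}) (gi gj : Z2) : {fset Z2} :=
  (A_of xi gi gj `|` A_of xi gj gi `|` [fset gi; gj])%fset.

Definition lin_form (a b : int) (g : Z2) : int := a * g.1 + b * g.2.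

Definition chooses (R : realType) (L : Z2 -> int) (xi : {fset Z2})
    (gi gj : Z2) : Prop :=
  [/\ gi \in xi /\ gj \in xi,
      det2 gi gj != 0,
      forall g, g \in xi -> L gi <= L g,
      forall g, g \in xi -> det2 gi g != 0 -> L gj <= L g
    & ~ Conv R (alg_step xi gi gj) (0, 0)].

Definition follows (R : realType) (L : Z2 -> int) (xi_ : nat -> {fset Z2}) :
    Prop :=
  forall k, exists gi gj : Z2,
    chooses R L (xi_ k) gi gj /\ xi_ k.+1 = alg_step (xi_ k) gi gj.

(* Main.v *)
(** Write [L] for the linear form and [gi], [gj] for the chosen pair. Both
    [L gi] and [L gj] can only decrease, hence are eventually constant, equal
    to [m <= n].

    If [0 < m], every element other than [gi], [gj] loses at least [m] at each
    step, so eventually [L <= n] everywhere; then subtracting [gj] from anything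
    not parallel to [gi] would give [L = 0], so all elements but [gj] are
    multiples of [gi].

    If [m = 0], [0 \notin Conv] makes [gi] the shortest element of [ker L], so
    it is eventually a constant [e]. Any other element moves down, by [e] or by
    [gj], and induction shows that it equals [x e + l gj] with [x] an integer and
    [l] a natural number, and that [gj] only changes to [gj - d e] with [0 <= d].
    While some [x] is negative, repeated subtraction of [gj] brings the element
    down to level [1] and forces [0 < d]; each such change raises the lower bound
    on [x] valid along pure [gj]-subtractions ([slope_witness]), so finally
    all [x] are nonnegative. *)

Require Import Defs.
From mathcomp Require Import all_boot all_order all_algebra finmap.
From mathcomp Require Import all_classical all_reals convex.
From mathcomp Require Import interval_inference zify ring.

Import Order.TTheory GRing.Theory Num.Theory.

Local Open Scope ring_scope.

Set Implicit Arguments.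
Unset Strict Implicit.
Unset Printing Implicit Defensive.

Lemma nonincreasing_stabilizes (f : nat -> nat) :
  (forall k, (f k.+1 <= f k)%N) -> exists K, forall k, (K <= k)%N -> f k = f K.
Proof.
move=> fS.
have fle k d : (f (k + d) <= f k)%N.
  by elim: d => [|d IH]; rewrite ?addn0// addnS (leq_trans (fS _)).
suff H n : forall k, (f k <= n)%N -> exists K, forall k, (K <= k)%N -> f k = f K.
  exact: (H _ 0%N (leqnn _)).
elim: n => [|n IH] k fk.
  by exists k => k' /subnKC <-; have := fle k (k' - k)%N; lia.
have [[d lt_d]|H] := pselect (exists d, (f (k + d) < f k)%N).
  by apply: (IH (k + d)%N); lia.
exists k => k' /subnKC <-; apply/eqP; rewrite eqn_leq fle leqNgt.
by apply/negP => lt; apply: H; exists (k' - k)%N.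
Qed.

(** * Integer combinations of two vectors, determinants and linear forms *)

Lemma Z2_eq (u v : Z2) : u.1 = v.1 -> u.2 = v.2 -> u = v.
Proof. by case: u v => [? ?] [? ?] /= -> ->. Qed.

Definition comb (u v : Z2) (x l : int) : Z2 := u *~ x + v *~ l.

Lemma comb1 u v x l : (comb u v x l).1 = u.1 * x + v.1 * l.
Proof. by rewrite /comb /= !(raddfMz fst) -!mulrzz. Qed.

Lemma comb2 u v x l : (comb u v x l).2 = u.2 * x + v.2 * l.
Proof. by rewrite /comb /= !(raddfMz snd) -!mulrzz. Qed.

Lemma det2_combl u v x l : det2 (comb u v x l) v = det2 u v * x.
Proof. by rewrite /det2 comb1 comb2; ring. Qed.

Lemma det2_combr u v x l : det2 u (comb u v x l) = det2 u v * l.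
Proof. by rewrite /det2 comb1 comb2; ring. Qed.

Lemma det2C u v : det2 u v = - det2 v u.
Proof. by rewrite /det2; ring. Qed.

Lemma det2vv u : det2 u u = 0.
Proof. by rewrite /det2 mulrC subrr. Qed.

Lemma lin_form_comb a b u v x l :
  lin_form a b (comb u v x l) = lin_form a b u * x + lin_form a b v * l.
Proof. by rewrite /lin_form comb1 comb2; ring. Qed.

Lemma lin_formB a b u v : lin_form a b (u - v) = lin_form a b u - lin_form a b v.
Proof. by rewrite /lin_form /=; ring. Qed.

Lemma comb10 u v : comb u v 1 0 = u.
Proof. by rewrite /comb mulr0z addr0. Qed.

Lemma comb01 u v : comb u v 0 1 = v.
Proof. by rewrite /comb mulr0z add0r. Qed.

Lemma combBl u v x l : comb u v x l - u = comb u v (x - 1) l.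
Proof. by apply: Z2_eq; rewrite /= ?comb1 ?comb2; ring. Qed.

Lemma combBr u v x l : comb u v x l - v = comb u v x (l - 1).
Proof. by apply: Z2_eq; rewrite /= ?comb1 ?comb2; ring. Qed.

Lemma comb_shear u v d x l : comb u (comb u v d 1) x l = comb u v (x + d * l) l.
Proof. by apply: Z2_eq; rewrite ?(comb1, comb2); ring. Qed.

Lemma det2_eq0_lin_form_inj a b u v :
  det2 u v = 0 -> lin_form a b u = lin_form a b v -> lin_form a b v != 0 -> u = v.
Proof.
rewrite /det2 => D E N.
have E1 : lin_form a b v * (u.1 - v.1) = 0.
  transitivity (b * (u.1 * v.2 - u.2 * v.1) +
    v.1 * (lin_form a b u - lin_form a b v)); last by rewrite D E; ring.
  by rewrite /lin_form; ring.
have E2 : lin_form a b v * (u.2 - v.2) = 0.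
  transitivity (- a * (u.1 * v.2 - u.2 * v.1) +
    v.2 * (lin_form a b u - lin_form a b v)); last by rewrite D E; ring.
  by rewrite /lin_form; ring.
by apply: Z2_eq; apply/eqP; rewrite -subr_eq0; have := mulfI N;
  move=> /(_ _ 0) I; apply/eqP/I; rewrite mulr0.
Qed.

(** The forms with coefficients [(a, b)] and [(b, - a)] are independent, since [a * a + b * b] is
    nonzero. So the second one serves as a coordinate on the kernel of the first. *)
Lemma lin_form_ker_inj a b u :
  ~ (a = 0 /\ b = 0) -> lin_form a b u = 0 -> lin_form b (- a) u = 0 -> u = 0.
Proof.
rewrite /lin_form => nz E1 E2.
have N : a * a + b * b != 0.
  apply/eqP => E; apply: nz.
  have : 0 <= a * a by rewrite -expr2 sqr_ge0.
  have : 0 <= b * b by rewrite -expr2 sqr_ge0.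
  move=> hb ha.
  have /eqP : a * a = 0 by lia.
  have /eqP : b * b = 0 by lia.
  by rewrite !mulf_eq0 !orbb => /eqP-> /eqP->.
apply: Z2_eq => /=; apply: (mulfI N); rewrite mulr0.
  transitivity (a * (a * u.1 + b * u.2) + b * (b * u.1 + - a * u.2)); first by ring.
  by rewrite E1 E2; ring.
transitivity (b * (a * u.1 + b * u.2) - a * (b * u.1 + - a * u.2)); first by ring.
by rewrite E1 E2; ring.
Qed.

Lemma det2_ker_eq0 a b u v : ~ (a = 0 /\ b = 0) ->
  lin_form a b u = 0 -> lin_form a b v = 0 -> det2 u v = 0.
Proof.
move=> nz; rewrite /lin_form /det2 => Eu Ev.
have [a0|aN] := eqVneq a 0.
  have bN : b != 0 by apply/eqP => b0; apply: nz.
  apply: (mulfI bN); rewrite mulr0.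
  transitivity (u.1 * (a * v.1 + b * v.2) - v.1 * (a * u.1 + b * u.2)); first by ring.
  by rewrite Eu Ev; ring.
apply: (mulfI aN); rewrite mulr0.
transitivity (v.2 * (a * u.1 + b * u.2) - u.2 * (a * v.1 + b * v.2)); first by ring.
by rewrite Eu Ev; ring.
Qed.

(** * Semigroup spans *)

Lemma semigroup_spanD xi x y :
  semigroup_span xi x -> semigroup_span xi y -> semigroup_span xi (x + y).
Proof.
move=> [c ->] [d ->]; exists (fun g => c g + d g)%N.
by rewrite -big_split /=; apply: eq_bigr => g _; rewrite mulrnDr.
Qed.

Lemma semigroup_span0 xi : semigroup_span xi 0.
Proof. by exists (fun=> 0%N); rewrite big1. Qed.

Lemma semigroup_spanMn xi x n : semigroup_span xi x -> semigroup_span xi (x *+ n).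
Proof.
move=> [c ->]; exists (fun g => c g * n)%N.
by rewrite -sumrMnl; apply: eq_bigr => g _; rewrite mulrnA.
Qed.

Lemma semigroup_span_mem (xi : {fset Z2}) g : g \in xi -> semigroup_span xi g.
Proof.
move=> gxi; exists (fun h => nat_of_bool (h == g)).
rewrite (bigD1_seq g) //= eqxx big1 ?addr0 // => h /negPf ->; exact: mulr0n.
Qed.

Lemma semigroup_span_sub (xi zeta : {fset Z2}) :
  (forall g, g \in xi -> semigroup_span zeta g) ->
  forall x, semigroup_span xi x -> semigroup_span zeta x.
Proof.
move=> sub x [c ->]; rewrite big_seq.
elim/big_ind: _; [exact: semigroup_span0 | exact: semigroup_spanD |].
by move=> g /sub gz; apply: semigroup_spanMn.
Qed.

Lemma nonneg_comb_generated (xi : {fset Z2}) u v :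
  u \in xi -> v \in xi -> det2 u v != 0 ->
  (forall g, g \in xi -> exists x l, [/\ 0 <= x, 0 <= l & g = comb u v x l]) ->
  generated_by_two (semigroup_span xi).
Proof.
move=> uxi vxi D H; exists u, v; split.
  by apply: contraNneq D => ->; rewrite det2vv.
apply/seteqP; split; apply: semigroup_span_sub => g; last first.
  by rewrite !inE => /orP[] /eqP ->; apply: semigroup_span_mem.
move=> /H[[x|x] [[l|l] [//= _ _ ->]]]; rewrite /comb -!pmulrn.
by apply: semigroup_spanD; apply: semigroup_spanMn; apply: semigroup_span_mem;
  rewrite !inE eqxx ?orbT.
Qed.

(** * Convex hulls that avoid the origin *)

Lemma barycenter_intr_eq0 (R : numFieldType) (x y : int) (p q : nat) :
    (0 < p)%N -> x *+ p + y *+ q = 0 ->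
  p%:R / (p + q)%:R * x%:~R + (1 - p%:R / (p + q)%:R) * y%:~R = 0 :> R.
Proof.
move=> p0 E.
have N0 : (p + q)%:R != 0 :> R by rewrite pnatr_eq0; lia.
have H : x%:~R * p%:R + y%:~R * q%:R = 0 :> R.
  by rewrite !mulr_natr -!rmorphMn -rmorphD /= E.
transitivity ((x%:~R * p%:R + y%:~R * q%:R) / (p + q)%:R : R); last by rewrite H mul0r.
by move: N0; rewrite natrD => N0; field.
Qed.

Lemma Conv0_of_opposite (R : realType) (xi : {fset Z2}) v w (p q : nat) :
  v \in xi -> w \in xi -> (0 < p)%N -> v *+ p + w *+ q = 0 -> Conv R xi (0, 0).
Proof.
move=> vxi wxi p0 E M [cM subM].
have l0 : 0 <= p%:R / (p + q)%:R :> R by rewrite divr_ge0 ?ler0n.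
have l1 : p%:R / (p + q)%:R <= 1 :> R.
  by rewrite ler_pdivrMr ?ltr0n ?addn_gt0 ?p0 // mul1r ler_nat leq_addr.
pose t : {i01 R} := Itv01 l0 l1.
have Mxi g : g \in xi -> embed R g \in M by move=> gxi; apply/mem_set/subM; exists g.
have := cM _ _ t (Mxi v vxi) (Mxi w wxi).
have -> : conv t (embed R v : convex_lmodType _) (embed R w) =
    t%:num *: embed R v + (1 - t%:num) *: embed R w by [].
rewrite [t%:num]/=.
have [E1 E2] : v.1 *+ p + w.1 *+ q = 0 /\ v.2 *+ p + w.2 *+ q = 0.
  by move: (congr1 fst E) (congr1 snd E); rewrite /= !(raddfMn fst) !(raddfMn snd).
suff -> : (p%:R / (p + q)%:R : R) *: embed R v +
    (1 - p%:R / (p + q)%:R) *: embed R w = (0, 0).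
  by move/set_mem.
apply: injective_projections => /=.
  exact: barycenter_intr_eq0 E1.
exact: barycenter_intr_eq0 E2.
Qed.

(** An integral consequence of the origin lying outside the hull. The case [q = 0] is allowed, so
    that it also excludes [0] from [xi]. *)
Definition pointed (xi : {fset Z2}) : Prop := forall v w (p q : nat),
  v \in xi -> w \in xi -> (0 < p)%N -> v *+ p + w *+ q <> 0.

Lemma pointed_neq0 (xi : {fset Z2}) g : pointed xi -> g \in xi -> g <> 0.
Proof.
move=> px gxi g0; apply: (px g g 1%N 0%N gxi gxi) => //.
by rewrite g0 !mul0rn addr0.
Qed.

(** On the line [ker L] all elements lie on one side of the origin: two on opposite sides, each
    weighted by the size of the other, would cancel. *)
Lemma pointed_ker_lt0 a b (xi : {fset Z2}) v w : ~ (a = 0 /\ b = 0) ->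
  pointed xi -> v \in xi -> w \in xi -> lin_form a b v = 0 -> lin_form a b w = 0 ->
  (lin_form b (- a) v < 0) = (lin_form b (- a) w < 0).
Proof.
move=> nz px.
wlog suff H : v w / v \in xi -> w \in xi -> lin_form a b v = 0 ->
    lin_form a b w = 0 -> lin_form b (- a) w < 0 -> lin_form b (- a) v < 0.
  by move=> vxi wxi Lv Lw; apply/idP/idP; apply: H.
move=> vxi wxi Lv Lw Sw; rewrite ltNge; apply/negP => Sv.
apply: (px v w `|lin_form b (- a) w|%N `|lin_form b (- a) v|%N vxi wxi); first by lia.
have -> : v *+ `|lin_form b (- a) w| + w *+ `|lin_form b (- a) v| =
    comb v w (- lin_form b (- a) w) (lin_form b (- a) v).
  by rewrite /comb 2!pmulrn; congr (_ *~ _ + _ *~ _); lia.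
by apply: (@lin_form_ker_inj a b) => //; rewrite lin_form_comb ?Lv ?Lw; ring.
Qed.

Lemma det2_eq0_lin_form0 a b e g :
  e <> 0 -> lin_form a b e = 0 -> det2 e g = 0 -> lin_form a b g = 0.
Proof.
move=> e0 Le D; apply/eqP/negP => /negP /mulfI N; apply: e0.
apply: Z2_eq; apply: N; rewrite /= mulr0.
  transitivity (g.1 * lin_form a b e + b * det2 e g); last by rewrite Le D; ring.
  by rewrite /lin_form /det2; ring.
transitivity (g.2 * lin_form a b e - a * det2 e g); last by rewrite Le D; ring.
by rewrite /lin_form /det2; ring.
Qed.

(** * A run of the algorithm: one step, and monotonicity of the chosen values *)

Section Run.

Variables (a b : int) (X : nat -> {fset Z2}) (gi gj : nat -> Z2).
Local Notation L := (lin_form a b).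

Hypothesis hab : ~ (a = 0 /\ b = 0).
Hypothesis L_ge0 : forall g, g \in X 0%N -> 0 <= L g.
Hypothesis pX : forall k, pointed (X k).
Hypothesis giX : forall k, gi k \in X k.
Hypothesis gjX : forall k, gj k \in X k.
Hypothesis gij : forall k, det2 (gi k) (gj k) != 0.
Hypothesis gi_min : forall k g, g \in X k -> L (gi k) <= L g.
Hypothesis gj_min : forall k g, g \in X k -> det2 (gi k) g != 0 -> L (gj k) <= L g.
Hypothesis XS : forall k, X k.+1 = alg_step (X k) (gi k) (gj k).

Lemma giXS k : gi k \in X k.+1.
Proof. by rewrite XS /alg_step !inE eqxx orbT. Qed.

Lemma gjXS k : gj k \in X k.+1.
Proof. by rewrite XS /alg_step !inE eqxx !orbT. Qed.

Lemma subi_mem k g :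
  g \in X k -> g <> gi k -> det2 g (gj k) != 0 -> g - gi k \in X k.+1.
Proof.
move=> gX /eqP Ni D; rewrite XS /alg_step !inE; apply/orP; left; apply/orP; left.
apply/imfsetP; exists g => //; rewrite !inE gX Ni D /= andbT.
by apply: contraNneq D => ->; rewrite det2vv.
Qed.

Lemma subj_mem k g :
  g \in X k -> g <> gj k -> det2 g (gi k) != 0 -> g - gj k \in X k.+1.
Proof.
move=> gX /eqP Nj D; rewrite XS /alg_step !inE; apply/orP; left; apply/orP; right.
apply/imfsetP; exists g => //; rewrite !inE gX Nj D /= andbT.
by apply: contraNneq D => ->; rewrite det2vv.
Qed.

Variant step_spec k (g : Z2) : Prop :=
  | StepI of g = gi k
  | StepJ of g = gj k
  | StepSubI h of h \in X k & g = h - gi k & det2 h (gj k) != 0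
  | StepSubJ h of h \in X k & g = h - gj k & det2 h (gi k) != 0 & h <> gj k.

Lemma stepP k g : g \in X k.+1 -> step_spec k g.
Proof.
rewrite XS /alg_step !inE => /orP[/orP[/imfsetP[h]|/imfsetP[h]]|].
- by rewrite !inE => /andP[hX /and3P[_ _ D]] ->; apply: (StepSubI hX).
- rewrite !inE => /andP[hX /and3P[/eqP N _ D]] ->; by apply: (StepSubJ hX).
- by case/orP => /eqP; [apply: StepI|apply: StepJ].
Qed.

Lemma L_ge0X k g : g \in X k -> 0 <= L g.
Proof.
elim: k g => [|k IH] g; first exact: L_ge0.
case/stepP => [->|->|h hX -> _|h hX -> D _]; try exact: IH.
  by rewrite lin_formB; have := gi_min hX; lia.
by rewrite lin_formB; rewrite det2C oppr_eq0 in D; have := gj_min hX D; lia.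
Qed.

Lemma L_giS k : L (gi k.+1) <= L (gi k).
Proof. exact/gi_min/giXS. Qed.

Lemma L_gi_le_gj k : L (gi k) <= L (gj k).
Proof. exact: gi_min. Qed.

(** By Cramer's rule, [det2 (gi k) (gj k)] times [g] is a combination of [gi k] and [gj k] whose
    coefficients are, up to sign, the two determinants of [g]. *)
Lemma det2_parallel k g : g <> 0 -> det2 g (gi k) = 0 -> det2 g (gj k) != 0.
Proof.
move=> g0 Di; apply/eqP => Dj; apply: g0.
apply: Z2_eq; apply: (mulfI (gij k)); rewrite /= mulr0.
  transitivity ((gi k).1 * det2 g (gj k) - (gj k).1 * det2 g (gi k)).
    by rewrite /det2; ring.
  by rewrite Di Dj; ring.
transitivity ((gi k).2 * det2 g (gj k) - (gj k).2 * det2 g (gi k)).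
  by rewrite /det2; ring.
by rewrite Di Dj; ring.
Qed.

(** The old [gj k] competes for the new [gj] unless it is parallel to [gi k.+1]. In that case [gi k]
    is not parallel to it and competes instead, with a value at most [L (gj k)]. *)
Lemma L_gjS k : L (gj k.+1) <= L (gj k).
Proof.
have [D|D] := eqVneq (det2 (gi k.+1) (gj k)) 0; last exact/gj_min/D/gjXS.
apply: le_trans (L_gi_le_gj k); apply: gj_min; first exact: giXS.
apply/eqP => D'.
have /negP := det2_parallel (pointed_neq0 (@pX k.+1) (giX k.+1)) D'.
by rewrite D.
Qed.

Lemma L_chosen_stabilizes : exists K, forall k, (K <= k)%N ->
  L (gi k) = L (gi K) /\ L (gj k) = L (gj K).
Proof.
(* Both summands are nonincreasing, so a constant sum makes each of them constant. *)
have [k|K HK] := @nonincreasing_stabilizes (fun k => `|L (gi k)| + `|L (gj k)|)%N.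
  have := L_giS k; have := L_gjS k; have := L_ge0X (giX k); have := L_ge0X (gjX k).
  by have := L_ge0X (giX k.+1); have := L_ge0X (gjX k.+1); lia.
exists K => k /[dup] /subnKC <-; elim: (k - K)%N => [|d IH Kk]; first by rewrite addn0.
have {}IH := IH (leq_addr _ _).
have := HK _ Kk; have := HK _ (leq_addr d K); rewrite /= !addnS.
have := L_giS (K + d); have := L_gjS (K + d).
have := L_ge0X (giX (K + d)); have := L_ge0X (gjX (K + d)).
have := L_ge0X (giX (K + d).+1); have := L_ge0X (gjX (K + d).+1); lia.
Qed.

(** * Stable values [m] and [n], and the case [0 < m] *)

Section Stable.

Variables (K : nat) (m n : int).
Hypothesis Lgi : forall k, (K <= k)%N -> L (gi k) = m.
Hypothesis Lgj : forall k, (K <= k)%N -> L (gj k) = n.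

Lemma subj_L_ge_m k g : (K <= k)%N -> g \in X k -> g <> gj k ->
  det2 g (gi k) != 0 -> m + n <= L g.
Proof.
move=> Kk gX N D; have := gi_min (subj_mem gX N D).
by rewrite Lgi ?(leqW Kk)// lin_formB Lgj//; lia.
Qed.

Lemma L_bounded k : exists N : nat, forall g, g \in X k -> L g <= N%:Z.
Proof.
exists (\sum_(g <- X k) `|L g|)%N => g gX.
by rewrite (bigD1_seq g) //=; lia.
Qed.

Lemma L_eventually_le : 0 < m -> exists2 K', (K <= K')%N &
  forall k g, (K' <= k)%N -> g \in X k -> L g <= n.
Proof.
move=> m0; have [N HN] := L_bounded K.
(* After [s] steps an element either descends from a chosen vector, with value at most [n], or has
   lost at least [1] at every step. *)
have H s g : g \in X (K + s) -> L g <= n \/ L g + s%:Z <= N%:Z.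
  elim: s g => [|s IH] g; first by rewrite addn0 => /HN; rewrite addr0; right.
  have Ks := leq_addr s K; have mn := L_gi_le_gj (K + s).
  rewrite Lgi // Lgj // in mn.
  rewrite addnS; case/stepP => [->|->|h hX -> _|h hX -> _ _];
    rewrite ?lin_formB ?Lgi ?Lgj//.
  - by left.
  - by left.
  - by have := IH _ hX; lia.
  - by have := IH _ hX; lia.
exists (K + N.+1)%N => [|k g Kk]; first exact: leq_addr.
have -> : k = (K + (k - K))%N by lia.
move=> gX; have := H _ _ gX; have := L_ge0X gX; lia.
Qed.

Lemma generated_pos : 0 < m -> exists k, generated_by_two (semigroup_span (X k)).
Proof.
move=> m0; have [K' KK' Lle] := L_eventually_le m0.
(* Induction on a bound for [L g], with [k] free because [g - gi k] lives in the next set. *)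
suff H (N : nat) k g : (K' <= k)%N -> g \in X k -> L g <= N%:Z ->
    g = gj k \/ exists2 x, 0 <= x & g = comb (gi k) (gj k) x 0.
  exists K'; apply: (nonneg_comb_generated (giX K') (gjX K') (gij K')) => g gX.
  have [|->|[x x0 ->]] := H `|L g|%N K' g (leqnn _) gX; first by lia.
    by exists 0, 1; rewrite comb01.
  by exists x, 0.
elim: N k g => [|N IH] k g K'k gX LN; have Kk := leq_trans KK' K'k.
  by have := gi_min gX; rewrite Lgi //; lia.
have [->|gNi] := pselect (g = gi k); first by right; exists 1; rewrite ?comb10.
have [->|gNj] := pselect (g = gj k); first by left.
have Dg : det2 g (gi k) = 0.
  apply/eqP/negP => /negP D.
  by have := subj_L_ge_m Kk gX gNj D; have := Lle _ _ K'k gX; lia.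
have gX' := subi_mem gX gNi (det2_parallel (pointed_neq0 (@pX k) gX) Dg).
have mg : m + m <= L g.
  by have := gi_min gX'; rewrite Lgi ?(leqW Kk)// lin_formB Lgi//; lia.
(* Otherwise [gi k] would compete for [gj k.+1], giving [n <= m], against [m + m <= L g <= n]. *)
have D : det2 (gi k.+1) (gi k) = 0.
  apply/eqP/negP => /negP D; have := gj_min (giXS k) D.
  by rewrite Lgj ?(leqW Kk)// Lgi//; have := Lle _ _ K'k gX; lia.
have giE : gi k.+1 = gi k.
  by apply: (@det2_eq0_lin_form_inj a b) => //; rewrite !Lgi ?(leqW Kk)//; lia.
have Dg' : det2 (g - gi k) (gi k) = 0 by move: Dg; rewrite /det2 /=; lia.
have [|E|[x x0 E]] := IH k.+1 (g - gi k) (leqW K'k) gX'.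
- by rewrite lin_formB Lgi//; lia.
- by have := gij k.+1; rewrite det2C giE -E Dg'.
- right; exists (x + 1); first by lia.
  rewrite -[g](subrK (gi k)) E /comb giE.
  by apply: Z2_eq; rewrite /= ?mulr0z ?mulrzDr ?addr0 //=.
Qed.

End Stable.


(** * The case [m = 0]: stabilization of [gi] *)

Section Zero.

Local Notation S := (lin_form b (- a)).

Lemma ker_neq0 k g : g \in X k -> L g = 0 -> S g != 0.
Proof.
move=> gX Lg; apply/eqP => Sg.
exact: (pointed_neq0 (@pX k) gX (lin_form_ker_inj hab Lg Sg)).
Qed.

(** Since [g - gi k] and [gi k] both lie in [X k.+1], they are on the same side of the origin in
    [ker L], so the sizes add without cancellation. *)
Lemma ker_subi k g : L (gi k) = 0 -> g \in X k -> L g = 0 -> g <> gi k ->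
  g - gi k \in X k.+1 /\ `|S g| = `|S (g - gi k)| + `|S (gi k)|.
Proof.
move=> Li gX Lg N.
have D : det2 g (gi k) = 0 by apply: det2_ker_eq0 hab Lg Li.
have gX' := subi_mem gX N (det2_parallel (pointed_neq0 (@pX k) gX) D); split=> //.
have Lg' : L (g - gi k) = 0 by rewrite lin_formB Lg Li subrr.
have := pointed_ker_lt0 hab (@pX k.+1) gX' (giXS k) Lg' Li.
by rewrite lin_formB; lia.
Qed.

Lemma gi_stabilizes K : (forall k, (K <= k)%N -> L (gi k) = 0) ->
  exists2 K', (K <= K')%N & forall k, (K' <= k)%N -> gi k = gi K'.
Proof.
move=> Li.
(* The old [gi k] survives in [X k.+1], where [gi k.+1] is subtracted from it if they differ. *)
have SS k : (K <= k)%N -> `|S (gi k.+1)| <= `|S (gi k)|.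
  move=> Kk; have [->//|N] := pselect (gi k = gi k.+1).
  have [_ ->] := ker_subi (Li _ (leqW Kk)) (giXS k) (Li _ Kk) N.
  by lia.
have [k|K' HK'] := @nonincreasing_stabilizes (fun k => `|S (gi (K + k))|%N).
  by rewrite addnS; have := SS _ (leq_addr k K); lia.
exists (K + K')%N => [|k Kk]; first exact: leq_addr.
have -> : k = (K + (K' + (k - (K + K'))))%N by lia.
elim: (k - (K + K'))%N => [|d <-]; first by rewrite addn0.
set k1 := (K + (K' + d))%N.
have Kk1 : (K <= k1)%N by exact: leq_addr.
have E : `|S (gi k1.+1)|%N = `|S (gi k1)|%N.
  have := HK' (K' + d).+1 (leqW (leq_addr _ _)).
  by rewrite /= -[in RHS](HK' (K' + d)%N) ?leq_addr // addnS.
rewrite !addnS -/k1; apply/eqP; rewrite -subr_eq0; apply/eqP.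
have := pointed_ker_lt0 hab (@pX k1.+1) (giX k1.+1) (giXS k1)
  (Li _ (leqW Kk1)) (Li _ Kk1).
by move=> sgn; apply: (lin_form_ker_inj hab); rewrite lin_formB ?Li ?leqW //; lia.
Qed.

(** * The case [m = 0] with [gi] constant: coordinates with respect to [e] and [gj] *)

Section StableZero.

Variables (K : nat) (e : Z2) (n : int).
Hypothesis giE : forall k, (K <= k)%N -> gi k = e.
Hypothesis Lgj : forall k, (K <= k)%N -> L (gj k) = n.
Hypothesis Le : L e = 0.

Local Notation pt k x l := (comb e (gj k) x l).

Lemma e_neq0 : e <> 0.
Proof. by rewrite -(giE (leqnn K)); apply: (pointed_neq0 (@pX K) (giX K)). Qed.

Lemma det2_gj k : (K <= k)%N -> det2 e (gj k) != 0.
Proof. by move=> Kk; rewrite -(giE Kk) gij. Qed.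

Lemma n_gt0 : 0 < n.
Proof.
rewrite -(Lgj (leqnn K)) lt_neqAle (L_ge0X (gjX K)) andbT eq_sym.
apply: contra (det2_gj (leqnn K)) => /eqP L0.
by apply/eqP; apply: det2_ker_eq0 hab Le L0.
Qed.

(** Descent on the size of [g] in [ker L]: [e] is subtracted at each step until [e] itself is
    reached. *)
Lemma ker_multiple k g : (K <= k)%N -> g \in X k -> L g = 0 ->
  exists2 c, 0 < c & g = e *~ c.
Proof.
have [N] := ubnP `|S g|%N; elim: N k g => // N IH k g SN Kk gX Lg.
have [->|Ne] := pselect (g = e); first by exists 1.
have Li : L (gi k) = 0 by rewrite giE.
rewrite -(giE Kk) in Ne.
have [gX' ES] := ker_subi Li gX Lg Ne.
have Se := ker_neq0 (giX k) Li.
have [||c c0 E] := IH k.+1 _ _ (leqW Kk) gX'; [lia|by rewrite lin_formB Lg Li|].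
exists (c + 1); first by lia.
by rewrite mulrzDr -E mulr1z giE // subrK.
Qed.

Lemma pt0_gt0 k k' x : (K <= k')%N -> pt k x 0 \in X k' -> 0 < x.
Proof.
move=> Kk' xX.
have L0 : L (pt k x 0) = 0 by rewrite lin_form_comb Le; ring.
have eX : e \in X k' by rewrite -(giE Kk').
have := pointed_ker_lt0 hab (@pX k') xX eX L0 Le.
have := ker_neq0 eX Le; have := ker_neq0 xX L0.
by rewrite lin_form_comb mulr0 addr0; nia.
Qed.

Lemma pt_level_gt0 k k' x l : (K <= k)%N -> (K <= k')%N -> x < 0 ->
  pt k x l \in X k' -> 0 < l.
Proof.
move=> Kk Kk' x0 xX; have := L_ge0X xX; have n0 := n_gt0.
rewrite lin_form_comb Le Lgj // mul0r add0r pmulr_rge0 // => l0.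
rewrite lt_neqAle l0 andbT; apply: contraTneq x0 => l0'.
by rewrite -leNgt ltW // (@pt0_gt0 k k') // l0'.
Qed.

(** If [gj] changes, the difference [gj k - gj k.+1] belongs to [X k.+2] and has level [0], hence is
    a positive multiple of [e]. *)
Lemma gjS k : (K <= k)%N -> exists2 d, 0 <= d & gj k.+1 = pt k (- d) 1.
Proof.
move=> Kk; have [<-|N] := pselect (gj k = gj k.+1).
  by exists 0; rewrite // oppr0 comb01.
have D : det2 (gj k) (gi k.+1) != 0.
  by rewrite giE ?leqW // det2C oppr_eq0 det2_gj.
have dX := subj_mem (gjXS k) N D.
have [||c c0 E] := ker_multiple _ dX.
- by rewrite !leqW.
- by rewrite lin_formB !Lgj ?leqW // subrr.
exists c; first exact: ltW.
by rewrite /comb mulrNz -E; apply: Z2_eq => /=; ring.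
Qed.

(** Induction on [L g]: [g - gj k] has coordinates for step [k.+1], and the shear by [d] carries
    them back to step [k]. *)
Lemma mem_pt k g : (K <= k)%N -> g \in X k ->
  exists x l, 0 <= l /\ g = pt k x l.
Proof.
have [N] := ubnP `|L g|%N; elim: N k g => // N IH k g LN Kk gX.
have [L0|LN0] := eqVneq (L g) 0.
  have [c _ ->] := ker_multiple Kk gX L0.
  by exists c, 0; rewrite /comb mulr0z addr0.
have [->|gNj] := pselect (g = gj k); first by exists 0, 1; rewrite comb01.
have D : det2 g (gi k) != 0.
  apply: contra LN0 => /eqP D; apply/eqP/(det2_eq0_lin_form0 e_neq0 Le).
  by rewrite det2C -(giE Kk) D oppr0.
have n0 := n_gt0; have gX' := subj_mem gX gNj D.
have := L_ge0X gX; have := L_ge0X gX'; rewrite lin_formB Lgj // => L1 L2.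
have [|x [l [l0 E]]] := IH k.+1 _ _ (leqW Kk) gX'; first by rewrite lin_formB Lgj//; lia.
have [d d0 Ej] := gjS Kk; rewrite Ej comb_shear in E.
exists (x + - d * l), (l + 1); split; first by lia.
by apply: (addIr (- gj k)); rewrite E combBr addrK.
Qed.

(** A negative [x] distinguishes the element from [gj k], and its positive level makes it
    nonparallel to [e], so [gj k] does get subtracted. *)
Lemma pt_down k x l : (K <= k)%N -> x < 0 -> pt k x l \in X k ->
  pt k x (l - 1) \in X k.+1.
Proof.
move=> Kk x0 xX; have l0 := pt_level_gt0 Kk Kk x0 xX; have Dj := det2_gj Kk.
rewrite -combBr; apply: subj_mem => //.
  move=> /(congr1 (fun g => det2 g (gj k))); rewrite det2_combl det2vv.
  by move/eqP; rewrite mulf_eq0 (negPf Dj) lt_eqF.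
by rewrite giE // det2C det2_combr oppr_eq0 mulf_eq0 (negPf Dj) gt_eqF.
Qed.

(* [x] itself is unbounded below, as subtractions of [e] go on at all levels
   [l >= 2]. But an element obtained by [c] such subtractions has a sibling where
   they are replaced by subtractions of [gj]; the bound [- B] concerns the latter.
   Coordinates are those of step [k], the set is that of step [k']. *)
Definition slope_witness (B : nat) k k' : Prop := forall x l, x < 0 ->
  pt k x l \in X k' -> exists c, [/\ 0 <= c, - B%:Z <= x + c, x + c < 0, 0 < l - c &
    pt k (x + c) (l - c) \in X k'].

(** The witness of the parent, moved down by [gj k], is a witness for the child. *)
Lemma slope_witness_step B k : (K <= k)%N ->
  slope_witness B k k -> slope_witness B k k.+1.
Proof.
move=> Kk J x l x0 /[dup] ptX /stepP; have Dj := det2_gj Kk.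
have xE y : det2 (pt k x l) (gj k) = det2 e (gj k) * y -> x = y.
  by rewrite det2_combl => /(mulfI Dj).
case=> [E|E|h hX E D|h hX E D N].
- by have := xE 1; rewrite E giE // mulr1 => /(_ erefl); lia.
- by have := xE 0; rewrite E mulr0 det2vv => /(_ erefl); lia.
- have Eh : h = pt k (x + 1) l.
    by apply: (addIr (- e)); rewrite combBl addrK E giE.
  (* A parent with first coordinate [0] is parallel to [gj k], and [e] is not subtracted from it.
     Hence [x + 1] is still negative and no new negative elements arise. *)
  move: D hX; rewrite {}Eh det2_combl mulf_eq0 negb_or => /andP[_ x1] hX.
  have [|c [c0 cB c1 lc cX]] := J _ _ _ hX; first by lia.
  have dX := pt_down Kk c1 cX; have := pt_level_gt0 Kk (leqW Kk) c1 dX.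
  exists (c + 1); split; try lia.
  by rewrite (_ : x + (c + 1) = x + 1 + c) 1?(_ : l - (c + 1) = l - c - 1) //; ring.
- have Eh : h = pt k x (l + 1).
    by apply: (addIr (- gj k)); rewrite combBr addrK E.
  rewrite {}Eh in hX.
  have [c [c0 cB c1 lc cX]] := J _ _ x0 hX.
  have dX := pt_down Kk c1 cX; have := pt_level_gt0 Kk (leqW Kk) c1 dX.
  exists c; split; try lia.
  by rewrite (_ : l - c = l + 1 - c - 1) //; ring.
Qed.

Lemma slope_witness_shear B k d : (K <= k)%N -> 0 < d -> gj k.+1 = pt k (- d) 1 ->
  slope_witness B.+1 k k -> slope_witness B k.+1 k.+1.
Proof.
move=> Kk d0 Ej /(slope_witness_step Kk) J x l x0 /[dup] ptX.
have l0 := pt_level_gt0 (leqW Kk) (leqW Kk) x0 ptX.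
rewrite [in X in X -> _]Ej comb_shear => /J[|c [c0 cB c1 lc _]]; first by nia.
(* The old witness gives [- B.+1 <= x - d * l + c]. As [d * l - c >= l - c >= 1], this yields
   [- B <= x], so the element is its own witness. *)
by exists 0; rewrite !addr0; split => //; nia.
Qed.

Lemma slope_witness_eventually (B : nat) k : (K <= k)%N -> slope_witness B k k ->
  exists2 k', (K <= k')%N & forall x l, pt k' x l \in X k' -> 0 <= x.
Proof.
elim: B k => [|B IH] k Kk J.
  exists k => // x l ptX; rewrite leNgt; apply/negP => x0.
  by have [c [_ + +]] := J _ _ x0 ptX; lia.
(* Arguing by contradiction turns any strict change of [gj] into an immediate end, since the
   hypothesis for [B] then applies. *)
apply: contrapT => NG.
(* Induction on the level: while [gj] is unchanged a negative element goes down one level per step,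
   and it cannot reach level [0]. *)
have H (l : nat) k1 x : (K <= k1)%N -> slope_witness B.+1 k1 k1 -> x < 0 ->
    pt k1 x l%:Z \in X k1 -> False.
  elim: l k1 => [|l IHl] k1 Kk1 J1 x0 ptX.
    by have := pt_level_gt0 Kk1 Kk1 x0 ptX.
  have [d d0 Ej] := gjS Kk1; have [d1|d1] := ltP 0 d.
    by apply: NG; apply: (IH k1.+1); [exact: leqW | exact: slope_witness_shear d1 Ej J1].
  have Ej' : gj k1.+1 = gj k1 by rewrite Ej (_ : - d = 0) ?comb01 //; lia.
  apply: (IHl k1.+1 (leqW Kk1)) => //; rewrite ?/slope_witness Ej'.
    exact: slope_witness_step.
  by have := pt_down Kk1 x0 ptX; rewrite (_ : l.+1%:Z - 1 = l%:Z) //; lia.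
apply: NG; exists k => // x [l|l] ptX; rewrite leNgt; apply/negP => x0.
  exact: H ptX.
by have := pt_level_gt0 Kk Kk x0 ptX.
Qed.

Lemma slope_witness_exists : exists B, slope_witness B K K.
Proof.
(* Here [det2 (pt K x l) (gj K)] is [x] times a nonzero integer, so the sum bounds every [x]. *)
exists (\sum_(g <- X K) `|det2 g (gj K)|)%N => x l x0 ptX.
exists 0; rewrite !addr0; split => //.
  have : (`|det2 (pt K x l) (gj K)| <= \sum_(g <- X K) `|det2 g (gj K)|)%N.
    by rewrite (bigD1_seq _ ptX) ?fset_uniq // leq_addr.
  by rewrite det2_combl abszM; have := det2_gj (leqnn K); nia.
exact: pt_level_gt0 ptX.
Qed.

Lemma generated_zero : exists k, generated_by_two (semigroup_span (X k)).
Proof.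
have [B J] := slope_witness_exists.
have [k Kk x_ge0] := slope_witness_eventually (leqnn K) J.
exists k; have eX : e \in X k by rewrite -(giE Kk).
apply: (nonneg_comb_generated eX (gjX k) (det2_gj Kk)) => g gX.
have [x [l [l0 E]]] := mem_pt Kk gX.
by exists x, l; split => //; apply: (x_ge0 x l); rewrite -E.
Qed.

End StableZero.

End Zero.

(** * Assembling the two cases *)

Lemma run_generated : exists k, generated_by_two (semigroup_span (X k)).
Proof.
have [K HK] := L_chosen_stabilizes.
have Lgi k : (K <= k)%N -> L (gi k) = L (gi K) by move=> /HK[].
have Lgj k : (K <= k)%N -> L (gj k) = L (gj K) by move=> /HK[].
have [L0|LN] := eqVneq (L (gi K)) 0.
  have [|K' KK' giE] := @gi_stabilizes K; first by move=> k /Lgi ->.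
  apply: (@generated_zero K' (gi K') (L (gj K))) => // [k /(leq_trans KK') /Lgj //|].
  by rewrite Lgi.
by apply: (generated_pos Lgi Lgj); rewrite lt_neqAle eq_sym LN (L_ge0X (giX K)).
Qed.

End Run.

Theorem theorem3p5 (R : realType) (xi : {fset Z2}) (a b : int)
    (hxi : monomial_exponents xi)
    (h0 : ~ Conv R xi (0, 0))
    (hab : ~ (a = 0 /\ b = 0))
    (hL : forall g, g \in xi -> 0 <= lin_form a b g)
    (xi_ : nat -> {fset Z2})
    (hinit : xi_ 0%N = xi)
    (hrun : follows R (lin_form a b) xi_) :
  exists k : nat, generated_by_two (semigroup_span (xi_ k)).
Proof.
have /choice[gi /choice[gj H]] := hrun.
(* For the initial set this comes from [h0], afterwards from the hull condition on the pair chosen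
   one step earlier. *)
have pX k : pointed (xi_ k).
  move=> v w p q vX wX p0 E.
  have := Conv0_of_opposite (R := R) vX wX p0 E.
  case: k vX wX => [|k] vX wX; first by rewrite hinit.
  by have [[_ _ _ _ + ->]] := H k.
apply: (@run_generated a b xi_ gi gj) => // [|k|k|k|k|k|k]; first by rewrite hinit.
all: by have [[[]]] := H k.
Qed.
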